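(* Let $I\subseteq\{1,\dots,n\}^2$ be a strict pattern with $|I|=n(n-1)/2$, and let $A\in L(n)$ be $I$-generic with $\mathcal{O}_A\cap L_I(n)\ne\emptyset$. Then the map $$\hat\theta:\mathcal{U}_A/T_n\to\mathcal{X}_A/T_n$$ induced by $\theta:\mathcal{U}_A\to\mathcal{X}_A$, $\theta(g)=g^{-1}Ag$, is bijective. Consequently, $N_{A,I}$ is the number of flags which reduce $A$ to $L_I(n)$.
   Context: $L(n)$ is the space of traceless complex $n\times n$ matrices; $T_n\subseteq\mathrm{U}(n)$ is the maximal torus of diagonal unitary matrices. A pattern is a finite set of ordered pairs of positive integers; it is strict if it contains no pair $(i,i)$. $L_I=L_I(n)$ is the subspace of all $X=[x_{ij}]\in L(n)$ with $x_{ij}=0$ for all $(i,j)\in I$. For $A\in L(n)$: $\mathcal{O}_A=\{UAU^{-1}:U\in\mathrm{U}(n)\}$ and $\mathcal{X}_A=L_I(n)\cap\mathcal{O}_A$. The torus $T_n$ acts on $\mathcal{X}_A$ on the right by $(X,t)\mapsto t^{-1}Xt$. $N_{A,I}$ is the cardinality of the set $\mathcal{X}_A/T_n$ of $T_n$-orbits in $\mathcal{X}_A$. Let $\mathcal{U}_A=\{g\in\mathrm{U}(n):g^{-1}Ag\in L_I\}$, on which $T_n$ acts by right multiplication; $\theta$ is surjective and $T_n$-equivariant. $\mathcal{O}_A$ intersects $L_I$ transversally at $B\in\mathcal{X}_A$ if the sum of $L_I(n)$ and the tangent space of $\mathcal{O}_A$ at $B$ is all of $L(n)$ (as real vector spaces).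 $A$ is $I$-generic if this holds at every $B\in\mathcal{X}_A$. A flag is a point $gT_n$ of the flag variety $\mathrm{U}(n)/T_n$; the flag $gT_n$ reduces $A$ to $L_I$ if $g^{-1}Ag\in L_I$. Thus $\mathcal{U}_A/T_n$ is the set of flags reducing $A$ to $L_I$. *)

(* Defs.v *)
From mathcomp Require Import all_boot all_order all_algebra.
From mathcomp Require Import all_classical all_reals all_analysis.
From mathcomp Require Import complex.
Export numFieldNormedType.Exports.
Set Implicit Arguments.
Unset Strict Implicit.
Unset Printing Implicit Defensive.
Import GRing.Theory Num.Theory.
Local Open Scope classical_set_scope.
Local Open Scope ring_scope.

(* The complex numbers are R[i] for R : realType (written complex R below);
   the index set {1, ..., n} is 'I_n, counted from 0. *)

Section Definitions.
Variables (R : realType) (n : nat).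
Local Notation C := (complex R).
Local Notation M := 'M[C]_n.

Definition unitary_group : set M := [set U | U \is unitarymx].

Definition diag_torus : set M := [set t | t \is unitarymx /\ is_diag_mx t].

Definition traceless : set M := [set X | \tr X = 0].

Definition strict_pattern (I : {set 'I_n * 'I_n}) : Prop :=
  forall i : 'I_n, (i, i) \notin I.

Definition pattern_space (I : {set 'I_n * 'I_n}) : set M :=
  [set X | traceless X /\ forall i j, (i, j) \in I -> X i j = 0].

Definition unitary_orbit (A : M) : set M :=
  [set U *m A *m invmx U | U in unitary_group].

Definition orbit_slice (A : M) (I : {set 'I_n * 'I_n}) : set M :=
  pattern_space I `&` unitary_orbit A.

Definition smooth (f : R -> R) : Prop :=
  forall (k : nat) (x : R), derivable (derive1n k f) x 1.

(* The orbit is an embedded compact submanifold of 'M_n, regarded as a real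
   vector space; its tangent vectors at B are the velocities at time 0 of the
   smooth curves which stay in it and are at B at time 0. Smoothness and
   velocity are read off the real and imaginary parts of the entries. *)
Definition orbit_tangent_space (A B : M) : set M :=
  [set W | exists gamma : R -> M,
    [/\ forall i j, smooth (fun x => complex.Re (gamma x i j)) /\
                    smooth (fun x => complex.Im (gamma x i j)),
        forall x, unitary_orbit A (gamma x),
        gamma 0 = B &
        forall i j,
          is_derive (0 : R) (1 : R)
            (fun x => complex.Re (gamma x i j)) (complex.Re (W i j)) /\
          is_derive (0 : R) (1 : R)
            (fun x => complex.Im (gamma x i j)) (complex.Im (W i j))]].

Definition transversal_at (A : M) (I : {set 'I_n * 'I_n}) (B : M) : Prop :=
  [set Y + W | Y in pattern_space I & W in orbit_tangent_space A B]
    = traceless.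

Definition generic (A : M) (I : {set 'I_n * 'I_n}) : Prop :=
  forall B : M, orbit_slice A I B -> transversal_at A I B.

Definition theta (A g : M) : M := invmx g *m A *m g.

Definition reducing_unitaries (A : M) (I : {set 'I_n * 'I_n}) : set M :=
  [set g | unitary_group g /\ pattern_space I (theta A g)].

(* Points of quotients by the torus are represented by the orbits themselves:
   the coset g T_n, and the orbit of X under X |-> t^-1 X t. *)
Definition torus_coset (g : M) : set M := [set g *m t | t in diag_torus].

Definition torus_orbit (X : M) : set M :=
  [set invmx t *m X *m t | t in diag_torus].

Definition flag_variety : set (set M) :=
  [set torus_coset g | g in unitary_group].

Definition reducing_unitaries_mod_torus (A : M) (I : {set 'I_n * 'I_n}) :
  set (set M) := [set torus_coset g | g in reducing_unitaries A I].

Definition orbit_slice_mod_torus (A : M) (I : {set 'I_n * 'I_n}) :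
  set (set M) := [set torus_orbit X | X in orbit_slice A I].

(* Independent of the representative, since the pattern space is stable under
   conjugation by the torus. *)
Definition flag_reduces (A : M) (I : {set 'I_n * 'I_n}) (F : set M) : Prop :=
  forall g : M, F g -> pattern_space I (theta A g).

Definition reducing_flags (A : M) (I : {set 'I_n * 'I_n}) : set (set M) :=
  [set F | flag_variety F /\ flag_reduces A I F].

Definition thetahat (A : M) (F : set M) : set M := theta A @` F.

Lemma thetahat_coset (A g : M) : unitary_group g ->
  thetahat A (torus_coset g) = torus_orbit (theta A g).
Proof.
move=> gU; rewrite /thetahat /torus_coset /torus_orbit image_comp.
apply: eq_imagel => t [tU _] /=; rewrite /theta !invmx_unitary //.
  by rewrite trmx_mul map_mxM !mulmxA.
exact: mul_unitarymx.
Qed.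

End Definitions.

(* Main.v *)
(** A unitary carrying one reducing flag of [A] to another one with the same
    image commutes with some [B] in the slice, so it suffices that the unitary
    stabilizer of [B] is diagonal. As a unitary is diagonal when its
    skew-Hermitian and Hermitian parts are, this is a statement on the
    skew-Hermitian [K] commuting with [B].

    If the tangent vectors of the orbit at [B] are of the form [[K, B]] with [K]
    skew-Hermitian, transversality makes [K |-> [K, B]] surjective modulo [L_I],
    from real dimension [n ^ 2] to [n (n - 1)]; its kernel contains the diagonal
    matrices, of dimension [n], hence equals them.

    A smooth curve in the orbit is [V_x B V_x^*] with [V_x] unitary, [V_0 = 1],
    but [V] need not be continuous. The matrices [a] such that [V_x a V_x^*] is
    differentiable at [0] form a *-algebra containing [B]. For a tight frame [e]
    of this algebra, [E x = \sum_i V_x e_i V_x^* e_i^*] is differentiable and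
    satisfies [E x a = (V_x a V_x^* ) E x], and [E 0] is invertible and commutes
    with the algebra. Differentiating this relation for [E x (E 0)^-1], at
    [a = B] and [a = B^*], gives the velocity as a commutator. *)
From HB Require Import structures.
Require Import Defs.
From mathcomp Require Import all_boot all_order all_algebra.
From mathcomp Require Import all_classical all_reals all_analysis.
From mathcomp Require Import complex ring zify.
Import Order.TTheory GRing.Theory Num.Theory.
Local Open Scope classical_set_scope.
Local Open Scope card_scope.
Local Open Scope ring_scope.
Local Open Scope sesquilinear_scope.

(** * Tight frames of matrix *-algebras and their Casimir sums *)

Section Frame.
Context {C : numClosedFieldType}.

Lemma adjmxM m n p (A : 'M[C]_(m, n)) (B : 'M[C]_(n, p)) :
  (A *m B) ^t* = B ^t* *m A ^t*.
Proof. by rewrite trmx_mul map_mxM. Qed.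

Lemma mxtrace_adj n (A : 'M[C]_n) : \tr (A ^t*) = (\tr A)^*.
Proof.
by rewrite /mxtrace rmorph_sum; apply: eq_bigr => i _; rewrite !mxE.
Qed.

Lemma mxtrace_mul_adj n (A B : 'M[C]_n) :
  \tr (A *m B ^t*) = (mxvec A *m (mxvec B) ^t*) 0 0.
Proof.
rewrite mxE (reindex _ (curry_mxvec_bij n n)) /=.
transitivity (\sum_i \sum_j A i j * (B i j)^* ).
  by apply: eq_bigr => i _; rewrite mxE; apply: eq_bigr => j _; rewrite !mxE.
rewrite pair_bigA; apply: eq_bigr => -[i j] _ /=.
by rewrite mxvecE !mxE mxvecE.
Qed.

(** Take [P] of maximal rank among the matrices with row space inside [D]. Adjoining a vector of [D]
    keeps the row space inside [D], so it cannot raise the rank. *)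
Lemma subspace_mx N (D : 'rV[C]_N -> Prop) :
  D 0 -> (forall k u v, D u -> D v -> D (k *: u + v)) ->
  exists P : 'M[C]_N, forall u, (u <= P)%MS <-> D u.
Proof.
move=> D0 DZ.
pose S (P : 'M[C]_N) := forall u : 'rV_N, (u <= P)%MS -> D u.
pose Q k := `[< exists2 P, S P & \rank P = k >].
have exQ : exists k, Q k.
  exists 0%N; apply/asboolP; exists 0; last by rewrite mxrank0.
  by move=> u; rewrite submx0 => /eqP->.
have ubQ k : Q k -> (k <= N)%N by move=> /asboolP[P _ <-]; exact: rank_leq_col.
case: (ex_maxnP exQ ubQ) => k /asboolP[P SP rP] kmax.
exists P => u; split; first exact: SP.
move=> Du; suff : (P + u <= P)%MS by apply: submx_trans; exact: addsmxSr.
have : (P <= P + u)%MS by exact: addsmxSl.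
move=> /mxrank_leqif_sup/geq_leqif <-; rewrite rP; apply: kmax.
apply/asboolP; exists (P + u)%MS => // w /sub_addsmxP[[w1 w2] /= ->].
rewrite addrC [w2]mx11_scalar mul_scalar_mx; apply: DZ => //.
by apply: SP; exact: submxMl.
Qed.

(** Gram-Schmidt on vectorized matrices: the trace form is the Hermitian product of the [mxvec]
    rows, and the [e i] are an orthonormal basis of [D] for it. *)
Lemma tight_frame n (D : 'M[C]_n -> Prop) :
  D 0 -> (forall k a b, D a -> D b -> D (k *: a + b)) ->
  exists r (e : 'I_r -> 'M[C]_n), (forall i, D (e i)) /\
    forall a, D a -> a = \sum_i \tr (a *m (e i) ^t*) *: e i.
Proof.
move=> D0 DZ.
have [||P PD] := @subspace_mx _ (fun v => D (vec_mx v)).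
- by rewrite linear0.
- by move=> k u v Du Dv; rewrite linearP; exact: DZ.
pose Q := schmidt (row_base P).
have Qu : Q \is unitarymx by apply: schmidt_unitarymx; exact: rank_leq_col.
have QP : (Q :=: P)%MS.
  by apply: eqmx_trans (eq_row_base P); apply/eqmx_schmidt_free/row_base_free.
exists (\rank P), (fun i => vec_mx (row i Q)); split=> [i|a Da].
  by apply/PD; rewrite -QP row_sub.
have /submxP[w aw] : (mxvec a <= Q)%MS by rewrite QP PD mxvecK.
apply: (can_inj mxvecK); rewrite linear_sum aw mulmx_sum_row.
apply: eq_bigr => i _; rewrite linearZ /= vec_mxK; congr (_ *: _).
rewrite mxtrace_mul_adj vec_mxK aw.
have -> : row i Q = delta_mx 0 i *m Q by rewrite rowE.
rewrite adjmxM mulmxA mulmxtVK //.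
by rewrite mxE (bigD1 i) //= !mxE !eqxx /= rmorph1 mulr1 big1 ?addr0 // => j ji;
  rewrite !mxE (negPf ji) rmorph0 mulr0.
Qed.

Section StarAlgebra.
Context {n r : nat} (D : 'M[C]_n -> Prop) (e : 'I_r -> 'M[C]_n).
Hypothesis (De : forall i, D (e i))
  (frameE : forall a, D a -> a = \sum_i \tr (a *m (e i) ^t*) *: e i).

(** If [v] kills the sum, the squared norms of the [v *m e i] add up to 0, so each [v *m e i]
    vanishes; expanding [1%:M] in the frame then gives [v = 0]. *)
Lemma casimir_unit : D 1%:M -> \sum_i e i *m (e i) ^t* \in unitmx.
Proof.
move=> D1; rewrite -row_free_unit; apply: inj_row_free => v vc0.
have ve i : v *m e i = 0.
  apply/eqP; rewrite -(dnorm_eq0 (@dotmx C n)) /= dotmxE; apply/eqP.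
  have : \sum_i dotmx (v *m e i) (v *m e i) = 0.
    transitivity ((v *m (\sum_i e i *m (e i) ^t* ) *m v ^t* ) 0 0).
      rewrite mulmx_sumr mulmx_suml summxE; apply: eq_bigr => j _.
      by rewrite dotmxE adjmxM !mulmxA.
    by rewrite vc0 mul0mx mxE.
  move/psumr_eq0P => /(_ _ i isT); rewrite dotmxE; apply.
  by move=> j _; exact: (dnorm_ge0 (@dotmx C n)).
rewrite -[v]mulmx1 (frameE _ D1) mulmx_sumr big1 // => i _.
by rewrite -scalemxAr ve scaler0.
Qed.

Hypothesis (DM : forall a b, D a -> D b -> D (a *m b))
  (DJ : forall a, D a -> D (a ^t*)).

(** In the frame, left multiplication by the adjoint of [a] has the conjugate transpose of the
    coefficients of left multiplication by [a]. Expanding and swapping the sums moves [a] to the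
    right end. *)
Lemma casimir_intertwine (V W a : 'M[C]_n) : D a ->
  \sum_i (V *m (a *m e i) *m W) *m (e i) ^t* =
  (\sum_i (V *m e i *m W) *m (e i) ^t* ) *m a.
Proof.
move=> Da.
under eq_bigr => i _.
  rewrite (frameE _ (DM _ _ Da (De i))) mulmx_sumr mulmx_suml mulmx_suml.
  under eq_bigr do rewrite -scalemxAr -!scalemxAl.
  over.
rewrite exchange_big mulmx_suml; apply: eq_bigr => j _ /=.
rewrite -mulmxA.
have -> : (e j) ^t* *m a = (a ^t* *m e j) ^t* by rewrite adjmxM trmxCK.
rewrite (frameE _ (DM _ _ (DJ _ Da) (De j))).
rewrite raddf_sum /= raddf_sum mulmx_sumr; apply: eq_bigr => i _.
rewrite linearZ /= map_mxZ -scalemxAr.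
have -> : \tr (a *m e i *m (e j) ^t* ) = (\tr (a ^t* *m e j *m (e i) ^t* ))^*.
  rewrite -mxtrace_adj !adjmxM !trmxCK [RHS]mxtrace_mulC -[in RHS]mulmxA.
  by rewrite [RHS]mxtrace_mulC.
by [].
Qed.

End StarAlgebra.
End Frame.

(** * Derivatives at 0 of curves of complex matrices *)

Section MatrixDerivative.
Context {R : realType}.
Local Notation C := (complex R).

(** Taken entrywise, this is the velocity condition of [orbit_tangent_space]. *)
Definition cderiv0 (f : R -> C) (d : C) : Prop :=
  is_derive (0 : R) (1 : R) (fun x => complex.Re (f x)) (complex.Re d) /\
  is_derive (0 : R) (1 : R) (fun x => complex.Im (f x)) (complex.Im d).

Lemma cderiv0_unique f d d' : cderiv0 f d -> cderiv0 f d' -> d = d'.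
Proof.
move=> [re im] [re' im']; apply/eqP; rewrite eq_complex.
by rewrite -(@derive_val _ _ _ _ _ _ _ re) -(@derive_val _ _ _ _ _ _ _ im)
  !derive_val !eqxx.
Qed.

Lemma cderiv0_cst c : cderiv0 (fun=> c) 0.
Proof. by split; exact: is_derive_cst. Qed.

Lemma cderiv0D f g a b : cderiv0 f a -> cderiv0 g b ->
  cderiv0 (fun x => f x + g x) (a + b).
Proof.
move=> [fr fi] [gr gi]; split; rewrite raddfD /=.
  by have := is_deriveD fr gr; congr is_derive; apply/funext => x /=; rewrite raddfD.
by have := is_deriveD fi gi; congr is_derive; apply/funext => x /=; rewrite raddfD.
Qed.

Lemma cderiv0M f g a b : cderiv0 f a -> cderiv0 g b ->
  cderiv0 (fun x => f x * g x) (a * g 0 + f 0 * b).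
Proof.
have ReM (x y : C) : complex.Re (x * y) =
    complex.Re x * complex.Re y - complex.Im x * complex.Im y.
  by case: x y => [? ?] [? ?].
have ImM (x y : C) : complex.Im (x * y) =
    complex.Re x * complex.Im y + complex.Im x * complex.Re y.
  by case: x y => [? ?] [? ?].
move=> [fr fi] [gr gi]; split; rewrite raddfD /=.
  rewrite !ReM.
  under eq_fun do rewrite ReM.
  apply: (is_derive_eq (is_deriveB (is_deriveM fr gr) (is_deriveM fi gi))).
  rewrite /GRing.scale /=; ring.
rewrite !ImM.
under eq_fun do rewrite ImM.
apply: (is_derive_eq (is_deriveD (is_deriveM fr gi) (is_deriveM fi gr))).
rewrite /GRing.scale /=; ring.
Qed.

Lemma cderiv0_sum (I : Type) (s : seq I) (f : I -> R -> C) (d : I -> C) :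
  (forall i, cderiv0 (f i) (d i)) ->
  cderiv0 (fun x => \sum_(i <- s) f i x) (\sum_(i <- s) d i).
Proof.
move=> fd; elim: s => [|i s IH].
  by under eq_fun do rewrite big_nil; rewrite big_nil; exact: cderiv0_cst.
by under eq_fun do rewrite big_cons; rewrite big_cons; exact: cderiv0D.
Qed.

Lemma cderiv0_conj f d : cderiv0 f d -> cderiv0 (fun x => (f x)^*) (d^*).
Proof.
have ReJ (x : C) : complex.Re (x^*) = complex.Re x by case: x.
have ImJ (x : C) : complex.Im (x^*) = - complex.Im x by case: x.
move=> [fr fi]; split.
  by rewrite ReJ; under eq_fun do rewrite ReJ.
by rewrite ImJ; under eq_fun do rewrite ImJ; exact: is_deriveN.
Qed.

Definition mxderiv0 {m n} (F : R -> 'M[C]_(m, n)) (D : 'M[C]_(m, n)) : Prop :=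
  forall i j, cderiv0 (fun x => F x i j) (D i j).

Lemma mxderiv0_unique m n (F : R -> 'M[C]_(m, n)) D D' :
  mxderiv0 F D -> mxderiv0 F D' -> D = D'.
Proof. by move=> FD FD'; apply/matrixP => i j; apply: cderiv0_unique. Qed.

Lemma mxderiv0_cst m n (A : 'M[C]_(m, n)) : mxderiv0 (fun=> A) 0.
Proof. by move=> i j; rewrite mxE; exact: cderiv0_cst. Qed.

Lemma mxderiv0D m n (F G : R -> 'M[C]_(m, n)) D E :
  mxderiv0 F D -> mxderiv0 G E -> mxderiv0 (fun x => F x + G x) (D + E).
Proof.
move=> FD GE i j; rewrite mxE; under eq_fun do rewrite mxE; exact: cderiv0D.
Qed.

Lemma mxderiv0_sum m n (I : Type) (s : seq I) (F : I -> R -> 'M[C]_(m, n)) D :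
  (forall i, mxderiv0 (F i) (D i)) ->
  mxderiv0 (fun x => \sum_(i <- s) F i x) (\sum_(i <- s) D i).
Proof.
move=> FD i j; rewrite summxE; under eq_fun do rewrite summxE.
by apply: cderiv0_sum => k; exact: FD.
Qed.

Lemma mxderiv0M m n p (F : R -> 'M[C]_(m, n)) (G : R -> 'M[C]_(n, p)) D E :
  mxderiv0 F D -> mxderiv0 G E ->
  mxderiv0 (fun x => F x *m G x) (D *m G 0 + F 0 *m E).
Proof.
move=> FD GE i j; rewrite !mxE -big_split /=; under eq_fun do rewrite mxE.
by apply: cderiv0_sum => k; exact: cderiv0M.
Qed.

Lemma mxderiv0_adj m n (F : R -> 'M[C]_(m, n)) D :
  mxderiv0 F D -> mxderiv0 (fun x => (F x) ^t*) (D ^t*).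
Proof.
move=> FD i j; rewrite !mxE; under eq_fun do rewrite !mxE.
exact: cderiv0_conj.
Qed.

End MatrixDerivative.

(** * Tangent vectors of the unitary orbit as commutators *)

Section Tangent.
Context {R : realType}.
Local Notation C := (complex R).
Context {n : nat}.
Local Notation M := 'M[C]_n.

Lemma adjmxK_unitary (U : M) : U \is unitarymx -> U ^t* *m U = 1%:M.
Proof.
by move=> Uu; rewrite -invmx_unitary // mulVmx // unitarymx_unit.
Qed.

(** The adjoint of the second equation says that [- K ^t*] solves the first one too; [S] is the
    average of these two solutions. *)
Lemma skew_part_commutator (K W B : M) :
  K *m B - B *m K = W -> K *m B ^t* - B ^t* *m K = W ^t* ->
  let S := 2^-1 *: (K - K ^t*) in S ^t* = - S /\ S *m B - B *m S = W.
Proof.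
move=> KB KBJ S; have h2 : (2^-1 : C)^* = 2^-1 by rewrite fmorphV rmorph_nat.
have KJB : B *m K ^t* - K ^t* *m B = W.
  by rewrite -[RHS]trmxCK -KBJ linearB map_mxB /= !adjmxM trmxCK.
split.
  by rewrite /S linearZ /= map_mxZ /= linearB map_mxB trmxCK h2 -scalerN opprB.
rewrite /S -scalemxAl -scalemxAr -scalerBr mulmxBl mulmxBr.
have -> : K *m B - K ^t* *m B - (B *m K - B *m K ^t* ) = W + W.
  rewrite -{1}KB -KJB opprB [LHS]addrACA [RHS]addrACA.
  by congr (_ + _); rewrite addrC.
by rewrite -mulr2n -[W *+ 2]scaler_nat scalerA mulVf ?scale1r // pnatr_eq0.
Qed.

Lemma conjugation_curve_velocity (V : R -> M) (B W : M) :
  (forall x, V x \is unitarymx) -> V 0 = 1%:M ->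
  mxderiv0 (fun x => V x *m B *m (V x) ^t*) W ->
  exists K : M, K ^t* = - K /\ K *m B - B *m K = W.
Proof.
move=> Vu V0 VW.
pose D a := exists d, mxderiv0 (fun x => V x *m a *m (V x) ^t*) d.
have VV x a b : (V x *m a *m (V x) ^t*) *m (V x *m b *m (V x) ^t*) =
    V x *m (a *m b) *m (V x) ^t*.
  by rewrite !mulmxA -[_ *m (V x) ^t* *m V x]mulmxA adjmxK_unitary // mulmx1.
have VJ x a : (V x *m a *m (V x) ^t*) ^t* = V x *m a ^t* *m (V x) ^t*.
  by rewrite !adjmxM trmxCK mulmxA.
have D0 : D 0.
  exists 0; under [X in mxderiv0 X]eq_fun do rewrite mulmx0 mul0mx.
  exact: mxderiv0_cst.
have D1 : D 1%:M.
  exists 0; have -> : (fun x => V x *m 1%:M *m (V x) ^t*) = fun=> 1%:M.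
    by apply/funext => x; rewrite mulmx1; exact/unitarymxP.
  exact: mxderiv0_cst.
have DZ k a b : D a -> D b -> D (k *: a + b).
  move=> [a' aP] [b' bP].
  (* The scalar [k] is treated as the constant curve [k%:M], so that the product rule applies. *)
  exists ((0 *m (V 0 *m a *m (V 0) ^t*) + k%:M *m a') + b').
  have -> : (fun x => V x *m (k *: a + b) *m (V x) ^t*) =
      fun x => k%:M *m (V x *m a *m (V x) ^t*) + V x *m b *m (V x) ^t*.
    apply/funext => x.
    by rewrite mulmxDr mulmxDl mul_scalar_mx -scalemxAr -scalemxAl.
  by apply: mxderiv0D => //; apply: mxderiv0M => //; exact: mxderiv0_cst.
have DM a b : D a -> D b -> D (a *m b).
  move=> [a' aP] [b' bP]; eexists.
  by under [X in mxderiv0 X]eq_fun do rewrite -VV; exact: mxderiv0M.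
have DJ a : D a -> D (a ^t*).
  move=> [a' aP]; eexists.
  by under [X in mxderiv0 X]eq_fun do rewrite -VJ; exact: mxderiv0_adj.
have [r [e [De eE]]] := tight_frame _ _ D0 DZ.
have /choice[d dP] := De.
pose E x := \sum_i (V x *m e i *m (V x) ^t*) *m (e i) ^t*.
have Ed : mxderiv0 E (\sum_i (d i *m (e i) ^t* +
    (V 0 *m e i *m (V 0) ^t*) *m 0)).
  apply: mxderiv0_sum => i; apply: mxderiv0M; first exact: dP.
  exact: mxderiv0_cst.
set S := \sum_i _ in Ed.
have E0 : E 0 = \sum_i e i *m (e i) ^t*.
  apply: eq_bigr => i _; rewrite V0 mul1mx.
  by rewrite trmx1 map_mx1 mulmx1.
have E0u : E 0 \in unitmx by rewrite E0; exact: (casimir_unit _ _ eE).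
have Ea x a : D a -> E x *m a = (V x *m a *m (V x) ^t*) *m E x.
  move=> Da; rewrite -(casimir_intertwine _ _ De eE DM DJ) // mulmx_sumr.
  by apply: eq_bigr => i _; rewrite -VV !mulmxA.
have V1 a : V 0 *m a *m (V 0) ^t* = a.
  by rewrite V0 mul1mx trmx1 map_mx1 mulmx1.
pose G x := E x *m invmx (E 0).
have Gd : mxderiv0 G (S *m invmx (E 0) + E 0 *m 0).
  by apply: (mxderiv0M _ _ _ E (fun=> invmx (E 0))) => //; exact: mxderiv0_cst.
set K := _ + _ in Gd.
have G0 : G 0 = 1%:M by rewrite /G mulmxV.
(* At 0 the relation [Ea] says that [E 0] commutes with [a], hence so does its inverse, and [G]
   inherits the relation from [E]. *)
have Ga x a : D a -> G x *m a = (V x *m a *m (V x) ^t*) *m G x.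
  move=> Da; rewrite /G mulmxA -Ea // -!mulmxA; congr (_ *m _).
  have := Ea 0 a Da; rewrite V1 => E0a.
  by apply: (can_inj (mulKmx E0u)); rewrite mulKVmx // mulmxA E0a mulmxK.
have KD a a' : mxderiv0 (fun x => V x *m a *m (V x) ^t*) a' ->
    K *m a - a *m K = a'.
  move=> aP; have Da : D a by exists a'.
  (* The two sides of [Ga] have derivatives [K *m a] and [a' + a *m K] at 0. *)
  have L := mxderiv0M _ _ _ _ _ _ _ Gd (mxderiv0_cst _ _ a).
  have := mxderiv0M _ _ _ _ _ _ _ aP Gd; rewrite V1 G0 mulmx1.
  under [X in mxderiv0 X]eq_fun do rewrite -Ga //.
  by move/(mxderiv0_unique _ _ _ _ _ L); rewrite mulmx0 addr0 => ->; rewrite addrK.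
have KB := KD _ _ VW.
have KBJ : K *m B ^t* - B ^t* *m K = W ^t*.
  apply: KD; under [X in mxderiv0 X]eq_fun do rewrite -VJ.
  exact: mxderiv0_adj.
by eexists; exact: (skew_part_commutator _ _ _ KB KBJ).
Qed.

(** Conjugating unitaries [U x] are chosen pointwise along the curve; the factor [(U 0) ^t*]
    normalizes them to be 1 at 0 and replaces [A] by [B]. *)
Lemma orbit_tangent_commutator (A B W : M) : orbit_tangent_space A B W ->
  exists K : M, K ^t* = - K /\ K *m B - B *m K = W.
Proof.
move=> [gamma [_ gO g0 gW]].
have /choice[U UP] x : exists U : M, U \is unitarymx /\
    U *m A *m U ^t* = gamma x.
  by have [U /= Uu <-] := gO x; exists U; split; rewrite ?invmx_unitary.
have Uu x : U x \is unitarymx by have [] := UP x.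
have UE x : U x *m A *m (U x) ^t* = gamma x by have [] := UP x.
apply: (@conjugation_curve_velocity (fun x => U x *m (U 0) ^t*)).
- by move=> x; apply: mul_unitarymx; rewrite // trmxC_unitary.
- exact/unitarymxP.
have -> : (fun x => U x *m (U 0) ^t* *m B *m (U x *m (U 0) ^t*) ^t*) = gamma.
  apply/funext => x; rewrite -g0 -!UE adjmxM trmxCK !mulmxA.
  rewrite -[_ *m (U 0) ^t* *m U 0]mulmxA adjmxK_unitary // mulmx1.
  by rewrite -[_ *m (U 0) ^t* *m U 0]mulmxA adjmxK_unitary // mulmx1.
by move=> i j; exact: gW.
Qed.

End Tangent.

(** * Rank-nullity and the dimension count *)

Lemma surjective_linear_inj (F : fieldType) (aT rT : vectType F) (f : aT -> rT) :
  linear f -> dim aT = dim rT -> (forall y, exists x, f x = y) ->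
  forall x, f x = 0 -> x = 0.
Proof.
move=> fL dimE fsurj x fx0.
pose mix := GRing.isLinear.Build F aT rT _ f fL.
pose g : {linear aT -> rT} := HB.pack f mix.
have gE y : linfun g y = f y by rewrite lfunE.
have imE : (linfun g @: fullv)%VS = fullv.
  apply/eqP; rewrite eqEsubv subvf; apply/subvP => y _.
  by have [z <-] := fsurj y; rewrite -gE memv_img ?memvf.
have := limg_ker_dim (linfun g) fullv.
rewrite imE !dimvf dimE -[RHS]add0n => /addIn/eqP.
rewrite dimv_eq0 capfv => /eqP kerE.
by apply/eqP; rewrite -memv0 -kerE memv_ker gE fx0.
Qed.

(** The division is exact by parity, and at [n = 0] the truncated [n - 1] is multiplied by 0. *)
Lemma half_pairs n : ((n * (n - 1) %/ 2).*2 + n = n * n)%N.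
Proof.
rewrite -muln2 divnK; first by case: n => [|m] //; lia.
by rewrite subn1 dvdn2 oddM; case: n => //= m; case: (odd m).
Qed.

(** * The commutant of a point of transversality is diagonal *)

Section SkewCommutant.
Context {R : realType} {n : nat}.
Local Notation C := (complex R).

(* A real-linear isomorphism from the real matrices onto the skew-Hermitian
   complex ones. *)
Definition skew_of_real (Z : 'M[R]_n) : 'M[C]_n :=
  \matrix_(i, j) ((Z i j - Z j i) +i* (Z i j + Z j i))%C.

Lemma skew_of_realP k Z Z' :
  skew_of_real (k *: Z + Z') = (k%:C)%C *: skew_of_real Z + skew_of_real Z'.
Proof.
by apply/matrixP => i j; rewrite !mxE; simpc; congr (_ +i* _)%C; ring.
Qed.

(** Off the diagonal [Z] is forced by its difference and sum with its transpose, which are the real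
    and imaginary parts of [K]. Its diagonal is free, and [v] absorbs the discrepancy there. *)
Lemma skew_of_real_diag (K : 'M[C]_n) (d : 'I_n -> R) : K ^t* = - K ->
  exists Z v, skew_of_real Z = K + diag_mx v /\ forall i, Z i i = d i.
Proof.
move=> Ks.
pose Z : 'M[R]_n := \matrix_(i, j) if i == j then d i
  else (complex.Re (K i j) + complex.Im (K i j)) / 2.
exists Z, (\row_i (skew_of_real Z i i - K i i)); split; last first.
  by move=> i; rewrite mxE eqxx.
apply/matrixP => i j; rewrite [RHS]mxE [X in _ = _ + X]mxE.
have [<-|ij] := eqVneq i j; first by rewrite [X in _ = _ + X]mxE addrC subrK.
rewrite addr0 !mxE (negPf ij) eq_sym (negPf ij).
have : (K ^t*) j i = (- K) j i by rewrite Ks.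
rewrite !mxE; case: (K i j) (K j i) => [a b] [a' b'] /= [-> /oppr_inj ->].
by congr (_ +i* _)%C; field.
Qed.

Context (I : {set 'I_n * 'I_n}) (B : 'M[C]_n).
Hypotheses (hcard : #|I| = (n * (n - 1) %/ 2)%N)
  (BI : forall i j, (i, j) \in I -> B i j = 0)
  (surjI : forall w : 'M[C]_n, exists2 K : 'M[C]_n, K ^t* = - K &
    forall i j, (i, j) \in I -> (K *m B - B *m K) i j = w i j).

Lemma commutator_diag_mx v i j : (i, j) \in I ->
  (diag_mx v *m B - B *m diag_mx v) i j = 0.
Proof.
by move=> ij; rewrite mul_diag_mx mul_mx_diag !mxE BI // mulr0 mul0r subrr.
Qed.

(* The real dimensions [n ^ 2] and [2 * #|I| + n] agree, so surjectivity of
   [K |-> [K, B]] modulo the pattern space leaves only the diagonal in its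
   kernel. *)
Lemma skew_commutant_diag (K : 'M[C]_n) :
  K ^t* = - K -> K *m B = B *m K -> is_diag_mx K.
Proof.
move=> Ks KB.
pose c Z := skew_of_real Z *m B - B *m skew_of_real Z.
pose p (k : 'I_#|I|) : 'I_n * 'I_n := enum_val k.
have pI k : ((p k).1, (p k).2) \in I by rewrite -surjective_pairing enum_valP.
have cP k Z Z' : c (k *: Z + Z') = (k%:C)%C *: c Z + c Z'.
  rewrite /c skew_of_realP mulmxDl mulmxDr -scalemxAl -scalemxAr.
  by rewrite scalerBr opprD addrACA.
have cE Z K' v : skew_of_real Z = K' + diag_mx v ->
    forall i j, (i, j) \in I -> c Z i j = (K' *m B - B *m K') i j.
  move=> ZE i j ij; rewrite /c ZE mulmxDl mulmxDr opprD addrACA mxE.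
  by rewrite commutator_diag_mx // addr0.
clearbody c.
(* Diagonal skew matrices are invisible to the first two components; recording the diagonal of [Z]
   supplies the remaining [n] dimensions. *)
pose Psi (Z : 'M[R]_n) : ('rV[R]_#|I| * 'rV[R]_#|I| * 'rV[R]_n)%type :=
  (\row_k complex.Re (c Z (p k).1 (p k).2),
   \row_k complex.Im (c Z (p k).1 (p k).2), \row_i Z i i).
have PsiL : linear Psi.
  move=> k Z Z'; rewrite /Psi; congr (_, _, _); apply/rowP => l;
    rewrite !mxE // cP !mxE;
    by case: (c Z _ _) (c Z' _ _) => [a b] [a' b']; simpc.
have Psi_surj y : exists Z, Psi Z = y.
  case: y => [[w1 w2] d].
  (* As [p] is injective, each sum has at most one term: [w] places the prescribed values on [I] and
     0 elsewhere. *)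
  pose w : 'M[C]_n := \matrix_(i, j) \sum_(k < #|I| | p k == (i, j))
    (w1 0 k +i* w2 0 k)%C.
  have wE k : w (p k).1 (p k).2 = (w1 0 k +i* w2 0 k)%C.
    rewrite mxE (big_pred1 k) // => l.
    by rewrite -surjective_pairing /= (inj_eq enum_val_inj).
  have [K' K's K'w] := surjI w.
  have [Z [v [ZE Zd]]] := skew_of_real_diag _ (fun i => d 0 i) K's.
  exists Z; rewrite /Psi; congr (_, _, _); apply/rowP => k; rewrite mxE //.
  - by rewrite (cE _ _ _ ZE) // K'w // wE.
  - by rewrite (cE _ _ _ ZE) // K'w // wE.
have dimE : dim 'M[R]_n = dim ('rV[R]_#|I| * 'rV[R]_#|I| * 'rV[R]_n)%type.
  change (n * n = 1 * #|I| + 1 * #|I| + 1 * n)%N.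
  by rewrite hcard !mul1n addnn half_pairs.
(* The representative with zero diagonal lies in the kernel of [Psi], so it is 0 and [K] is the
   diagonal correction alone. *)
have [Z [v [ZE Zd]]] := skew_of_real_diag _ (fun=> 0) Ks.
have Z0 : Z = 0.
  apply: (surjective_linear_inj _ _ _ _ PsiL dimE Psi_surj).
  rewrite /Psi; congr (_, _, _); apply/rowP => k; rewrite !mxE ?Zd //;
    by rewrite (cE _ _ _ ZE) // KB subrr mxE.
have -> : K = diag_mx (- v).
  apply/eqP; rewrite linearN /= -addr_eq0 -ZE Z0; apply/eqP/matrixP => i j.
  by rewrite !mxE subrr addr0.
exact: diag_mx_is_diag.
Qed.

(** By unitarity [u ^t*] commutes with [B] as well. The difference of [u] and [u ^t*], and ['i]
    times their sum, are then skew-Hermitian matrices commuting with [B]. *)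
Lemma unitary_commutant_diag (u : 'M[C]_n) :
  u \is unitarymx -> u *m B = B *m u -> is_diag_mx u.
Proof.
move=> uu uB.
have uJB : u ^t* *m B = B *m u ^t*.
  rewrite -[LHS]mulmx1 -(unitarymxP uu) mulmxA -[_ *m B *m u]mulmxA -uB.
  by rewrite !mulmxA adjmxK_unitary // mul1mx.
have /is_diag_mxP d1 : is_diag_mx (u - u ^t*).
  apply: skew_commutant_diag; last by rewrite mulmxBl mulmxBr uB uJB.
  by rewrite linearB map_mxB /= trmxCK opprB.
have /is_diag_mxP d2 : is_diag_mx ('i *: (u + u ^t*)).
  apply: skew_commutant_diag.
    rewrite linearZ map_mxZ /= conjCi linearD map_mxD /= trmxCK scaleNr.
    by rewrite addrC.
  by rewrite -scalemxAl -scalemxAr mulmxDl mulmxDr uB uJB.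
apply/is_diag_mxP => i j ij; move: (d1 i j ij) (d2 i j ij).
rewrite !mxE => /eqP; rewrite subr_eq0 => /eqP <- /eqP.
by rewrite mulf_eq0 (negPf (neq0Ci _)) /= -mulr2n mulrn_eq0 /= => /eqP.
Qed.

End SkewCommutant.

(** * Torus cosets, reducing flags and diagonal stabilizers *)

Section Flags.
Context {R : realType} {n : nat}.
Local Notation M := 'M[complex R]_n.
Implicit Types (A B g h t X : M) (I : {set 'I_n * 'I_n}).

Lemma unitary_groupP g : unitary_group g <-> g \is unitarymx.
Proof. by []. Qed.

Lemma diag_torusP t : diag_torus t <-> t \is unitarymx /\ is_diag_mx t.
Proof. by []. Qed.

Lemma reducing_unitariesP A I g : reducing_unitaries A I g <->
  g \is unitarymx /\ pattern_space I (theta A g).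
Proof. by []. Qed.

Lemma adjmx_unitary g : g \is unitarymx -> g ^t* \is unitarymx.
Proof. by rewrite trmxC_unitary. Qed.

Lemma thetaE A g : g \is unitarymx -> theta A g = g ^t* *m A *m g.
Proof. by move=> gu; rewrite /theta invmx_unitary. Qed.

Lemma thetaM A g t : g \is unitarymx -> t \is unitarymx ->
  theta A (g *m t) = t ^t* *m theta A g *m t.
Proof.
move=> gu tu; rewrite (thetaE _ _ gu) (thetaE _ _ (mul_unitarymx gu tu)).
by rewrite adjmxM !mulmxA.
Qed.

Lemma diag_torusM s t : diag_torus s -> diag_torus t -> diag_torus (s *m t).
Proof.
move=> /diag_torusP[su /diag_mxP[a sa]] /diag_torusP[tu /diag_mxP[b tb]].
apply/diag_torusP; split; first exact: (mul_unitarymx su tu).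
rewrite sa tb mul_diag_mx; apply/is_diag_mxP => i j /negPf ij.
by rewrite !mxE -val_eqE ij mulr0n mulr0.
Qed.

Lemma diag_torusJ t : diag_torus t -> diag_torus (t ^t*).
Proof.
move=> /diag_torusP[tu /is_diag_mxP td]; apply/diag_torusP.
split; first by rewrite trmxC_unitary.
by apply/is_diag_mxP => i j ij; rewrite !mxE td ?rmorph0 // eq_sym.
Qed.

Lemma diag_torus1 : diag_torus (1%:M : M).
Proof.
apply/diag_torusP; split; last exact: scalar_mx_is_diag.
by apply/unitarymxP; rewrite trmx1 map_mx1 mulmx1.
Qed.

Lemma torus_cosetM g t : diag_torus t -> torus_coset (g *m t) = torus_coset g.
Proof.
move=> tT; have [tu _] := (diag_torusP _).1 tT.
apply/seteqP; split=> _ [s sT <-].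
  by exists (t *m s); [exact: diag_torusM|rewrite mulmxA].
exists (t ^t* *m s); first exact: (diag_torusM _ _ (diag_torusJ _ tT) sT).
by rewrite -mulmxA [t *m _]mulmxA (unitarymxP tu) mul1mx.
Qed.

Lemma pattern_space_torus I X t :
  diag_torus t -> pattern_space I X -> pattern_space I (t ^t* *m X *m t).
Proof.
move=> tT [X0 XI]; have [tu _] := (diag_torusP _).1 tT; split.
  by rewrite /traceless /= mxtrace_mulC mulmxA (unitarymxP tu) mul1mx.
have [_ /diag_mxP[a ->]] := (diag_torusP _).1 (diag_torusJ _ tT).
have [_ /diag_mxP[b ->]] := (diag_torusP _).1 tT.
move=> i j ij; rewrite mul_mx_diag mul_diag_mx !mxE.
by rewrite XI // mulr0 mul0r.
Qed.

(** One reducing representative of a flag is enough, since conjugation by the torus preserves the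
    pattern space. *)
Lemma reducing_flagsE A I :
  reducing_flags A I = reducing_unitaries_mod_torus A I.
Proof.
apply/seteqP; split=> [F [[g gu <-] gr]|_ [g /reducing_unitariesP[gu gI] <-]].
  exists g => //; apply/reducing_unitariesP; split; first exact/unitary_groupP.
  by apply: gr; exists 1%:M; [exact: diag_torus1|rewrite mulmx1].
split; first by exists g => //; exact/unitary_groupP.
move=> _ [t tT <-]; have [tu _] := (diag_torusP _).1 tT.
by rewrite thetaM //; exact: pattern_space_torus.
Qed.

Lemma orbit_slice_theta A I g :
  reducing_unitaries A I g -> orbit_slice A I (theta A g).
Proof.
move=> /reducing_unitariesP[gu gI]; split=> //; exists (g ^t*).
  by apply/unitary_groupP; rewrite trmxC_unitary.
by rewrite thetaE // -invmx_unitary // invmxK.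
Qed.

Lemma orbit_sliceP A I X : orbit_slice A I X ->
  exists2 g, reducing_unitaries A I g & theta A g = X.
Proof.
move=> [XI [U /unitary_groupP Uu UX]].
have E : theta A (invmx U) = X by rewrite /theta invmxK.
exists (invmx U); last exact: E.
apply/reducing_unitariesP; split; last by rewrite E.
by rewrite (invmx_unitary Uu); exact: (adjmx_unitary _ Uu).
Qed.

(** Strictness makes [w'], the extension of [w] by 0 off [I], traceless; in its decomposition the
    pattern-space part vanishes on [I], leaving only the commutator there. *)
Lemma transversal_commutator_surj A I B : strict_pattern I ->
  transversal_at A I B -> forall w : M, exists2 K : M, K ^t* = - K &
    forall i j, (i, j) \in I -> (K *m B - B *m K) i j = w i j.
Proof.
move=> Istrict tr w.
pose w' : M := \matrix_(i, j) if (i, j) \in I then w i j else 0.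
have : traceless w'.
  by rewrite /traceless /= /mxtrace big1 // => i _; rewrite mxE (negPf (Istrict i)).
rewrite -tr => -[Y [_ YI] [W /orbit_tangent_commutator[K [Ks KW]]] YW].
exists K => // i j ij; have := congr1 (fun Z : M => Z i j) YW.
by rewrite /= KW !mxE YI // ij add0r.
Qed.

Lemma generic_stabilizer_diag A I B u : strict_pattern I ->
  #|I| = (n * (n - 1) %/ 2)%N -> generic A I -> orbit_slice A I B ->
  u \is unitarymx -> u *m B = B *m u -> is_diag_mx u.
Proof.
move=> Istrict Icard gen BX uu uB; have [[_ BI] _] := BX.
apply: (unitary_commutant_diag _ _ Icard BI _ _ uu uB).
exact: (transversal_commutator_surj _ _ _ Istrict (gen _ BX)).
Qed.

End Flags.

Theorem theorem8p4 (R : realType) (n : nat) (I : {set 'I_n * 'I_n})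
    (A : 'M[complex R]_n)
    (hI : strict_pattern I)
    (hcard : #|I| = (n * (n - 1) %/ 2)%N)
    (hA : traceless A)
    (hgen : generic A I)
    (hne : orbit_slice A I !=set0) :
  set_bij (reducing_unitaries_mod_torus A I) (orbit_slice_mod_torus A I)
    (thetahat A)
  /\ (orbit_slice_mod_torus A I #= reducing_flags A I)%card.
Proof.
have bij : set_bij (reducing_unitaries_mod_torus A I)
    (orbit_slice_mod_torus A I) (thetahat A).
  split.
  - move=> _ [g gr <-]; have [gu _] := (reducing_unitariesP _ _ _).1 gr.
    rewrite thetahat_coset; last exact/unitary_groupP.
    by exists (theta A g) => //; exact: orbit_slice_theta.
  - move=> _ _ /set_mem[g gr <-] /set_mem[h hr <-].
    have [gu _] := (reducing_unitariesP _ _ _).1 gr.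
    have [hu _] := (reducing_unitariesP _ _ _).1 hr.
    rewrite !thetahat_coset; try exact/unitary_groupP.
    move=> gh.
    have : torus_orbit (theta A h) (theta A h).
      by exists 1%:M; [exact: diag_torus1|rewrite invmx1 mul1mx mulmx1].
    rewrite -gh => -[t tT]; have [tu _] := (diag_torusP _).1 tT.
    rewrite (invmx_unitary tu) -(thetaM _ _ _ gu tu) => gth.
    rewrite -(torus_cosetM _ _ tT).
    have gtu := mul_unitarymx gu tu.
    (* Now [k] represents the flag of [g] and has exactly the same image under [theta A] as [h], so
       [k ^t* *m h] stabilizes that image. *)
    move: (g *m t) gtu gth => k gtu gth.
    have uu := mul_unitarymx (adjmx_unitary _ gtu) hu.
    have uB : k ^t* *m h *m theta A h = theta A h *m (k ^t* *m h).
      rewrite -[in RHS]gth (thetaE _ _ hu) (thetaE _ _ gtu) !mulmxA.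
      rewrite -[_ *m h *m h ^t*]mulmxA (unitarymxP hu) mulmx1.
      by rewrite -[_ *m k *m k ^t*]mulmxA (unitarymxP gtu) mulmx1.
    have ud := generic_stabilizer_diag _ _ _ _ hI hcard hgen
      (orbit_slice_theta _ _ _ hr) uu uB.
    (* The factor [k ^t* *m h] lies in the torus, and multiplying [k] by it gives [h]. *)
    rewrite -(torus_cosetM k _ ((diag_torusP _).2 (conj uu ud))).
    by rewrite mulmxA (unitarymxP gtu) mul1mx.
  - move=> _ [X /orbit_sliceP[g gr <-] <-].
    have [gu _] := (reducing_unitariesP _ _ _).1 gr.
    exists (torus_coset g); first by exists g.
    by apply: thetahat_coset; exact/unitary_groupP.
(* [#=] is equipotence of sets, so the bijection itself gives the count. *)
split=> //; rewrite reducing_flagsE; apply/card_esym/card_set_bijP.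
by exists (thetahat A).
Qed.
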